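(* Let $0<a<b<c$ (collared case) or $b<0<a<c$ (transverse case), and let $\nu\in\mathbb R\setminus\{0,a,b,c\}$. If the billiard trajectories inside the $\mathcal H$-ellipse $\mathcal C_0$ with caustic $\mathcal{C}_\nu$ are $n$-periodic, then there exist real polynomials $\widehat{p}_n$ and $\widehat{q}_{n-2}$ of degrees $n$ and $n-2$, respectively, which satisfy the Pell equation $$\widehat{p}_n(s)^2-\Big(\frac1a-s\Big)\Big(\frac1b-s\Big)\Big(\frac1c-s\Big)\Big(\frac1\nu-s\Big)\widehat{q}_{n-2}(s)^2=1 .$$
   Context: Minkowski 3-space is $\mathbb R^3$ with the form $\langle v,w\rangle=-v_xw_x+v_yw_y+v_zw_z$. The hyperboloid $\mathcal H:\ -x^2+y^2+z^2=1$ carries the induced Lorentz metric; its geodesics are the intersections of $\mathcal H$ with planes through the origin. The confocal family of conics on $\mathcal H$ is $$\mathcal C_\lambda:\quad -\frac{x^2}{a-\lambda}+\frac{y^2}{b-\lambda}+\frac{z^2}{c-\lambda}=0 ,\qquad (x,y,z)\in\mathcal H .$$ $\mathcal C_0$ is called a collared $\mathcal H$-ellipse if $0<a<b<c$ (one compact domain in its complement) and a transverse $\mathcal H$-ellipse if $b<0<a<c$ (two compact domains). Billiard: motion along geodesics of $\mathcal H$ with reflection at $\mathcal C_0$ given by $v\mapsto v-2\frac{\langle v,N\rangle}{\langle N,N\rangle}N$, where $N$ is a normal vector to $\mathcal C_0$ in $T_P\mathcal H$; at points where $N$ is light-like the trajectory returns along the same segment in the opposite direction. All segments of a given billiard trajectory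 are tangent to one conic $\mathcal C_\nu$ of the confocal family, its caustic; that is, the planes through the origin containing the segments are tangent to the cone $-\frac{x^2}{a-\nu}+\frac{y^2}{b-\nu}+\frac{z^2}{c-\nu}=0$ (this is the meaning of ''caustic $\mathcal C_\nu$'' also when the cone does not meet $\mathcal H$). A trajectory is $n$-periodic if it closes after $n$ reflections. *)

(* Defs.v *)
From HB Require Import structures.
From mathcomp Require Import all_boot all_order all_algebra.
From mathcomp Require Import all_classical all_reals all_analysis.

Set Implicit Arguments.
Unset Strict Implicit.
Unset Printing Implicit Defensive.

Import Order.TTheory GRing.Theory Num.Theory.
Import numFieldNormedType.Exports.

Local Open Scope classical_set_scope.
Local Open Scope ring_scope.

Section HyperboloidBilliard.
Variable R : realType.
Local Notation vec := 'rV[R]_3.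

(* Coordinates 0, 1, 2 are x, y, z. *)
Definition diag_form (l m k : R) (u v : vec) : R :=
  l * u 0 0 * v 0 0 + m * u 0 1 * v 0 1 + k * u 0 2%R * v 0 2%R.

Definition mink (u v : vec) : R := diag_form (-1) 1 1 u v.

Definition hyperboloid : set vec := [set p | mink p p = 1].

Definition confocal_form (a b c lam : R) (u v : vec) : R :=
  diag_form (- (a - lam)^-1) (b - lam)^-1 (c - lam)^-1 u v.

Definition cone (a b c lam : R) : set vec :=
  [set p | confocal_form a b c lam p p = 0].

Definition conic (a b c lam : R) : set vec :=
  hyperboloid `&` cone a b c lam.

(* Union of the connected components of the complement of C_0 in the
   hyperboloid that have compact closure. *)
Definition inside (a b c : R) : set vec :=
  [set p | (hyperboloid `\` conic a b c 0) p /\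
     compact (closure
       (connected_component (hyperboloid `\` conic a b c 0) p))].

(* The geodesic arc from P to P' is the radial projection to the hyperboloid
   of the chord from P to P', so it lies in the plane spanned by P and P'.  All
   arcs shorter than a half turn arise this way.  A longer arc starting at a
   point P of C_0 contains -P, again a point of C_0, so it is never a billiard
   segment; an arc from P to -P with interior inside C_0 lies in a plane tangent
   to the cone C_0, which is excluded for caustics C_nu with nu <> 0.
   If the chord leaves the region <q, q> > 0, the radial projection takes the
   value 0 there, which is not in the hyperboloid. *)
Definition geodesic_arc (P P' : vec) (t : R) : vec :=
  let q := (1 - t) *: P + t *: P' in (Num.sqrt (mink q q))^-1 *: q.

(* The derivatives of [geodesic_arc P P'] at t = 0 and at t = 1, for P and P'
   in the hyperboloid. *)
Definition departure (P P' : vec) : vec := P' - mink P P' *: P.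
Definition arrival (P P' : vec) : vec := mink P P' *: P' - P.

Definition billiard_segment (a b c : R) (P P' : vec) : Prop :=
  [/\ conic a b c 0 P, conic a b c 0 P' &
      forall t : R, 0 < t < 1 -> inside a b c (geodesic_arc P P' t)].

Definition tangent_hyperboloid (P : vec) : set vec := [set v | mink P v = 0].

Definition tangent_conic0 (a b c : R) (P : vec) : set vec :=
  tangent_hyperboloid P `&` [set v | confocal_form a b c 0 P v = 0].

Definition normal_conic0 (a b c : R) (P N : vec) : Prop :=
  [/\ N != 0, tangent_hyperboloid P N &
      forall v, tangent_conic0 a b c P v -> mink N v = 0].

Definition reflection (N v : vec) : vec :=
  if mink N N == 0 then - v else v - (2 * (mink v N / mink N N)) *: N.

(* [P k] is the k-th boundary point.  Velocities are compared up to a positive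
   factor, since [departure] and [arrival] depend on the parametrization of
   the arcs; they agree up to the same factor with the velocities of an
   affinely parametrized geodesic. *)
Definition billiard_trajectory (a b c : R) (P : nat -> vec) : Prop :=
  (forall k, billiard_segment a b c (P k) (P k.+1)) /\
  (forall k, exists N, normal_conic0 a b c (P k.+1) N /\
     exists2 mu : R, 0 < mu &
       departure (P k.+1) (P k.+2) =
       mu *: reflection N (arrival (P k) (P k.+1))).

(* No reflection takes place at a point with light-like normal.  Reversing at
   such a point is the limit of two successive reflections of nearby
   trajectories, so a trajectory through such a point closes after fewer
   reflections than its neighbours with the same caustic. *)
Definition regular_trajectory (a b c : R) (P : nat -> vec) : Prop :=
  billiard_trajectory a b c P /\
  forall k N, normal_conic0 a b c (P k) N -> mink N N != 0.

Definition plane_through (P P' : vec) : set vec :=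
  [set v | exists s t : R, v = s *: P + t *: P'].

(* The tangent plane to the cone along the line spanned by q is the polar
   plane of q. *)
Definition tangent_to_cone (a b c nu : R) (Pi : set vec) : Prop :=
  exists q : vec, [/\ q != 0, cone a b c nu q &
    Pi = [set v | confocal_form a b c nu q v = 0]].

Definition has_caustic (a b c nu : R) (P : nat -> vec) : Prop :=
  forall k, tangent_to_cone a b c nu (plane_through (P k) (P k.+1)).

Definition periodic_trajectory (n : nat) (P : nat -> vec) : Prop :=
  forall k, P (k + n)%N = P k.

(* The nonemptiness clause is needed: for some nu there is no trajectory with
   caustic C_nu at all. *)
Definition trajectories_periodic (a b c nu : R) (n : nat) : Prop :=
  (exists P, regular_trajectory a b c P /\ has_caustic a b c nu P) /\
  (forall P, regular_trajectory a b c P -> has_caustic a b c nu P ->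
     periodic_trajectory n P).

End HyperboloidBilliard.

(* Main.v *)
Require Import Defs.
From mathcomp Require Import all_boot all_order all_algebra.
From mathcomp Require Import all_classical all_reals all_analysis.
From mathcomp Require Import separable ring lra zify.

Import Order.TTheory GRing.Theory Num.Theory.
Local Open Scope ring_scope.

(** The proof is a Lax-pair argument.  Let A = diag(a, b, c), so that the
confocal form is F_l(u, v) = <(A - l)^-1 u, v>, and put s = 1/l.

At a point P of the boundary C_0 the normal is N = A^-1 P.  The resolvent
identity (A - l)^-1 A^-1 = s ((A - l)^-1 - A^-1) gives
F_l(N, u) = s (F_l(P, u) - <N, u>), and from it one computes that replacing a
velocity v by its reflection v - k N changes the values of F_l on P and v
exactly as replacing v by v - k s P would.  Since v enters only through its
plane, consecutive bounce points satisfy, as far as the form F_l can see, a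
three-term recurrence
   P_{k+2} ~ (t_k - rho_k s) P_{k+1} - mu_k P_k,   mu_k > 0, rho_k <> 0
([reflection_recurrence], [pencil_recurrence]).  After n steps the Gram matrix
G of F_l on (P_0, P_1), cleared of denominators, has become M^T G M, where M
is a product of n matrices linear in s with constant positive determinants
([monodromy]).  Periodicity says M^T G M = G, hence det M = 1.

For J a quarter turn this means that M commutes with the traceless matrix J G.
By Cauchy-Binet, det G has degree 4 in s, with roots 1/a, 1/b, 1/c, and 1/nu,
the last one because the plane of P_0 and P_1 is tangent to the cone C_nu:
det G = - g^2 D with D the quartic of the Pell equation
([pencil_gram_det_quartic]).  As D is squarefree, the entries of G have no
common factor, so M = p + q J G / g with polynomials p and q, and
1 = det M = p^2 - D q^2 ([pell_of_isometry]).  The trace 2 p has degree n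
because its leading coefficient is, up to sign, the product of the rho_k; the
degree of q then follows from the equation. *)

(** * Isometries of a binary quadratic form over polynomials *)

Section BinaryForms.
Set Implicit Arguments.
Unset Strict Implicit.

(** The coefficient q is obtained by applying to m a Bezout combination that
takes the value 1 on l. *)
Lemma proportional_to_primitive (F : fieldType) (l1 l2 l3 m1 m2 m3 : {poly F}) :
  coprimep (gcdp l1 l2) l3 ->
  m1 * l2 = m2 * l1 -> m1 * l3 = m3 * l1 -> m2 * l3 = m3 * l2 ->
  exists q, [/\ m1 = q * l1, m2 = q * l2 & m3 = q * l3].
Proof.
move=> cop e12 e13 e23.
have [u hu] := Bezoutp l1 l2.
move: cop; rewrite -(eqp_coprimepl _ hu) => /Bezout_eq1_coprimepP [v hv].
set w1 := v.1 * u.1; set w2 := v.1 * u.2.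
have e1 : w1 * l1 + w2 * l2 + v.2 * l3 = 1 by rewrite -hv /w1 /w2; ring.
exists (w1 * m1 + w2 * m2 + v.2 * m3); split.
- rewrite -[LHS]mulr1 -e1.
  transitivity (w1 * m1 * l1 + w2 * (m1 * l2) + v.2 * (m1 * l3)); first by ring.
  by rewrite e12 e13; ring.
- rewrite -[LHS]mulr1 -e1.
  transitivity (w1 * (m2 * l1) + w2 * m2 * l2 + v.2 * (m2 * l3)); first by ring.
  by rewrite -e12 e23; ring.
- rewrite -[LHS]mulr1 -e1.
  transitivity (w1 * (m3 * l1) + w2 * (m3 * l2) + v.2 * m3 * l3); first by ring.
  by rewrite -e13 -e23; ring.
Qed.

(** The square of a common factor of A, B and C divides A C - B^2, and D has no
square factor. *)
Lemma primitive_of_separable_det (F : fieldType) (A B C D : {poly F}) (g : F) :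
  g != 0 -> separable_poly D -> A * C - B ^+ 2 = - (g ^+ 2 *: D) ->
  coprimep (gcdp B C) A.
Proof.
move=> g0 sepD detE; rewrite coprimep_def.
apply/negP => /negP d1.
set d := gcdp (gcdp B C) A in d1.
have dB : d %| B := dvdp_trans (dvdp_gcdl _ _) (dvdp_gcdl _ _).
have dC : d %| C := dvdp_trans (dvdp_gcdl _ _) (dvdp_gcdr _ _).
have dA : d %| A := dvdp_gcdr _ _.
have : d ^+ 2 %| D.
  rewrite -(dvdpZr _ _ (expf_neq0 2 g0)) -dvdpNr -detE.
  by rewrite dvdp_sub ?dvdp_exp2r // expr2 dvdp_mul.
by rewrite (separable_nosquare sepD).
Qed.

(** In matrix terms G = (A B; B C), M = (x y; z w), M^T G M = G and det M = 1.
Then G M = adj(M)^T G, which says that the traceless part of M is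
proportional to (B, C, -A), the entries of J G. *)
Lemma pell_of_isometry (F : fieldType) (A B C D x y z w : {poly F}) (g : F) :
  (2%:R : F) != 0 -> g != 0 -> separable_poly D ->
  A * C - B ^+ 2 = - (g ^+ 2 *: D) ->
  x * w - y * z = 1 ->
  A * x ^+ 2 + 2 * B * x * z + C * z ^+ 2 = A ->
  A * x * y + B * (x * w + y * z) + C * z * w = B ->
  A * y ^+ 2 + 2 * B * y * w + C * w ^+ 2 = C ->
  exists q, (2^-1 *: (x + w)) ^+ 2 - D * q ^+ 2 = 1.
Proof.
move=> nz2 g0 sepD detE det1 e00 e01 e11.
have h2 : (2^-1)%:P * 2 = 1 :> {poly F}.
  by rewrite -(rmorph_nat (@polyC F) 2) -polyCM mulVf.
set k : {poly F} := (2^-1)%:P in h2.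
(* The entries of G M = adj(M)^T G. *)
have f00 : A * x + B * z = w * A - z * B.
  rewrite -[LHS]mulr1 -det1 -[X in _ = w * X - _]e00 -[X in _ = _ - z * X]e01; ring.
have f01 : A * y + B * w = w * B - z * C.
  rewrite -[LHS]mulr1 -det1 -[X in _ = w * X - _]e01 -[X in _ = _ - z * X]e11; ring.
have f11 : B * y + C * w = x * C - y * B.
  rewrite -[LHS]mulr1 -det1 -[X in _ = x * X - _]e11 -[X in _ = _ - y * X]e01; ring.
have [q [hd hy hz]] : exists q,
    [/\ k * (x - w) = q * B, y = q * C & z = q * - A].
  apply: proportional_to_primitive.
  - rewrite -scaleN1r coprimepZr ?oppr_eq0 ?oner_eq0 //.
    exact: primitive_of_separable_det sepD detE.
  - transitivity (k * (x * C - y * B) - k * (C * w) + k * y * B); first by ring.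
    rewrite -f11; transitivity ((k * 2) * (y * B)); first by ring.
    by rewrite h2 mul1r.
  - transitivity (k * (w * A - z * B) - k * (A * x) + k * z * B); first by ring.
    rewrite -f00; transitivity ((k * 2) * (z * B)); first by ring.
    by rewrite h2 mul1r.
  - transitivity (w * B - (A * y + B * w)); first by ring.
    by rewrite f01; ring.
exists (g *: q).
have -> : D * (g *: q) ^+ 2 = - (q ^+ 2) * (- (g ^+ 2 *: D)).
  by rewrite -!mul_polyC; ring.
rewrite -detE -det1 -mul_polyC -/k.
have -> : - q ^+ 2 * (A * C - B ^+ 2) = (q * - A) * (q * C) + (q * B) ^+ 2.
  ring.
rewrite -hz -hy -hd.
transitivity ((k * 2) ^+ 2 * (x * w) - y * z); first by ring.
by rewrite h2; ring.
Qed.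

End BinaryForms.

(** * The monodromy of the three-term recurrence *)

Section Monodromy.
Set Implicit Arguments.
Unset Strict Implicit.
Variable R : realType.

Lemma size_linear_mulD (t rho : R) (w r : {poly R}) :
  rho != 0 -> w != 0 -> (size r <= size w)%N ->
  size ((t%:P - rho%:P * 'X) * w + r) = (size w).+1.
Proof.
move=> rho0 w0 hr.
have sT : size (t%:P - rho%:P * 'X) = 2.
  rewrite addrC -mulNr -polyCN size_MXaddC polyC_eq0 oppr_eq0 (negPf rho0) /=.
  by rewrite size_polyC oppr_eq0 rho0.
have T0 : t%:P - rho%:P * 'X != 0 by rewrite -size_poly_eq0 sT.
have sTw : size ((t%:P - rho%:P * 'X) * w) = (size w).+1.
  by rewrite size_mul // sT.
by rewrite size_polyDl sTw // ltnS.
Qed.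

(** Here al k and be k play the role of the values of a symmetric form on
(v_k, v_k) and (v_k, v_{k+1}), for vectors that satisfy formally
v_{k+2} = T_k v_{k+1} - mu_k v_k with T_k of degree 1; then
v_k = x v_0 + z v_1 and v_{k+1} = y v_0 + w v_1.  The degree of w grows by one
at each step and exceeds those of y and z, so w dominates the trace. *)
Lemma monodromy (al be : nat -> {poly R}) :
  (forall k, exists t mu rho : R, [/\ 0 < mu, rho != 0,
     be k.+1 = (t%:P - rho%:P * 'X) * al k.+1 - mu%:P * be k &
     al k.+2 = (t%:P - rho%:P * 'X) ^+ 2 * al k.+1
       - 2 * mu%:P * (t%:P - rho%:P * 'X) * be k + mu%:P ^+ 2 * al k]) ->
  forall k, exists x y z w : {poly R}, exists2 d : R, 0 < d &
    [/\ x * w - y * z = d%:P,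
        al 0%N * x ^+ 2 + 2 * be 0%N * x * z + al 1%N * z ^+ 2 = al k,
        al 0%N * x * y + be 0%N * (x * w + y * z) + al 1%N * z * w = be k,
        al 0%N * y ^+ 2 + 2 * be 0%N * y * w + al 1%N * w ^+ 2 = al k.+1 &
        [/\ (size x <= k.+1)%N, (size y <= k)%N, (size z <= k)%N,
         size w = k.+1 & size (x + w) = k.+1]].
Proof.
move=> rec; elim=> [|k [x [y [z [w [d d0 [hd e00 e01 e11 [sx sy sz sw _]]]]]]]].
  exists 1, 0, 0, 1, 1 => //.
  rewrite size_poly1 size_poly0 -(natrD _ 1 1) -polyC_natr size_polyC.
  by rewrite pnatr_eq0 /=; split=> //; ring.
have [t [mu [rho [mu0 rho0 eb ea]]]] := rec k.
set T := t%:P - rho%:P * 'X in eb ea *.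
have w0 : w != 0 by rewrite -size_poly_gt0 sw.
have sN (p : {poly R}) : size (- (mu%:P * p)) = size p.
  by rewrite size_polyN mul_polyC size_scale // gt_eqF.
exists y, (T * y - mu%:P * x), w, (T * w - mu%:P * z), (mu * d).
  exact: mulr_gt0.
split.
- by rewrite polyCM -hd; ring.
- exact: e11.
- by rewrite eb -e11 -e01; ring.
- by rewrite ea -e11 -e01 -e00; ring.
have sT : (size T <= 2)%N.
  rewrite (leq_trans (size_polyD _ _)) // geq_max -mulNr -polyCN size_polyC.
  rewrite (leq_trans (leq_b1 _)) // mul_polyC (leq_trans (size_scale_leq _ _)) //.
  by rewrite size_polyX.
split.
- exact: leq_trans sy (leqW (leqnSn _)).
- rewrite (leq_trans (size_polyD _ _)) // geq_max sN sx andbT.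
  have [->|y0] := eqVneq y 0; first by rewrite mulr0 size_poly0.
  rewrite (leq_trans (size_polyMleq _ _)) //.
  by rewrite -subn1 leq_subLR (leq_add sT sy).
- by rewrite sw.
- by rewrite size_linear_mulD // ?sN ?sw // ltnW.
- rewrite addrCA size_linear_mulD // ?sw //.
  by rewrite (leq_trans (size_polyD _ _)) // geq_max sN !(leq_trans _ (leqnSn k)).
Qed.

End Monodromy.

(** * Vectors of Minkowski space and the confocal pencil *)

Section Billiard.
Set Implicit Arguments.
Unset Strict Implicit.
Context {R : realType}.
Local Notation vec := 'rV[R]_3.
Implicit Types (a b c : R) (u v w P Q N : vec).

Lemma vec3P u v :
  u 0 0 = v 0 0 -> u 0 1 = v 0 1 -> u 0 2%R = v 0 2%R -> u = v.
Proof.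
move=> e0 e1 e2; apply/rowP => -[[|[|[|//]]] hi].
- by rewrite (_ : Ordinal hi = 0) //; apply/val_inj.
- by rewrite (_ : Ordinal hi = 1) //; apply/val_inj.
- by rewrite (_ : Ordinal hi = 2%R) //; apply/val_inj.
Qed.

(** This is A^-1 P for A = diag(a, b, c), so that <A^-1 P, v> is the confocal
form of parameter 0; for P in C_0 it is normal to C_0 at P. *)
Definition conormal a b c P : vec := \row_j (P 0 j / [:: a; b; c]`_j).

(** With s = 'X = 1/l this is the confocal form of parameter l multiplied by
(a s - 1)(b s - 1)(c s - 1) / s. *)
Definition pencil a b c u v : {poly R} :=
  (a%:P * 'X - 1) * (b%:P * 'X - 1) * (u 0 2%R * v 0 2%R)%:P
  + (a%:P * 'X - 1) * (c%:P * 'X - 1) * (u 0 1 * v 0 1)%:P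
  - (b%:P * 'X - 1) * (c%:P * 'X - 1) * (u 0 0 * v 0 0)%:P.

Lemma pencilC a b c u v : pencil a b c u v = pencil a b c v u.
Proof. by rewrite /pencil !(mulrC (u 0 _)). Qed.

Lemma pencil_linear3 a b c (k l m : R) u v w x :
  pencil a b c (k *: u - l *: v - m *: w) x =
  k%:P * pencil a b c u x - l%:P * pencil a b c v x - m%:P * pencil a b c w x.
Proof. by rewrite /pencil !mxE; ring. Qed.

(** The resolvent identity (A - l)^-1 A^-1 = s ((A - l)^-1 - A^-1), cleared of
denominators. *)
Lemma pencil_conormal a b c P u : a != 0 -> b != 0 -> c != 0 ->
  pencil a b c (conormal a b c P) u = 'X * pencil a b c P u
   - (a%:P * 'X - 1) * (b%:P * 'X - 1) * (c%:P * 'X - 1)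
     * (mink (conormal a b c P) u)%:P.
Proof.
move=> a0 b0 c0; set N := conormal a b c P.
have -> : P = \row_j (N 0 j * [:: a; b; c]`_j).
  by apply: vec3P; rewrite !mxE /= divfK.
by rewrite /pencil /mink /diag_form !mxE /=; ring.
Qed.

(** The vector product for the Minkowski form: <u x v, w> is the determinant of
u, v, w. *)
Definition mcross u v : vec := \row_j
  [:: u 0 2%R * v 0 1 - u 0 1 * v 0 2%R; u 0 2%R * v 0 0 - u 0 0 * v 0 2%R;
      u 0 0 * v 0 1 - u 0 1 * v 0 0]`_j.

Lemma minkC u v : mink u v = mink v u.
Proof. by rewrite /mink /diag_form; ring. Qed.

Lemma minkDZl (k l : R) u v w :
  mink (k *: u + l *: v) w = k * mink u w + l * mink v w.
Proof. by rewrite /mink /diag_form !mxE; ring. Qed.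

Lemma mink_mcrossl u v : mink u (mcross u v) = 0.
Proof. by rewrite /mink /diag_form !mxE /=; ring. Qed.

Lemma mink_mcrossr u v : mink v (mcross u v) = 0.
Proof. by rewrite /mink /diag_form !mxE /=; ring. Qed.

Lemma mink_mcross_mcross u v :
  mink (mcross u v) (mcross u v) = mink u v ^+ 2 - mink u u * mink v v.
Proof. by rewrite /mink /diag_form !mxE /=; ring. Qed.

(** Cramer's rule: <u x v, w> x is the combination of v x w, w x u and u x v
with coefficients <u, x>, <v, x> and <w, x>. *)
Lemma mink_frame_eq0 u v w x : mink (mcross u v) w != 0 ->
  mink u x = 0 -> mink v x = 0 -> mink w x = 0 -> x = 0.
Proof.
move=> d0 xu xv xw.
have : mink (mcross u v) w *: x = 0.
  transitivity (mink u x *: mcross v w + mink v x *: mcross w u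
                + mink w x *: mcross u v).
    by apply: vec3P; rewrite /mink /diag_form !mxE /=; ring.
  by rewrite xu xv xw !scale0r !addr0.
by move/eqP; rewrite scaler_eq0 (negPf d0) => /eqP.
Qed.

Lemma confocal_conormal a b c u v :
  confocal_form a b c 0 u v = mink (conormal a b c u) v.
Proof. by rewrite /confocal_form /mink /diag_form !mxE /= !subr0; ring. Qed.

Lemma confocal_formC a b c (l : R) u v :
  confocal_form a b c l u v = confocal_form a b c l v u.
Proof. by rewrite /confocal_form /diag_form; ring. Qed.

(** The Cauchy-Binet formula for a diagonal form. *)
Lemma confocal_gram_det a b c (l : R) u v :
  l != a -> l != b -> l != c ->
  let w := mcross u v in
  confocal_form a b c l u u * confocal_form a b c l v v
  - confocal_form a b c l u v ^+ 2
  = ((a - l) * w 0 0 ^+ 2 - (b - l) * w 0 1 ^+ 2 - (c - l) * w 0 2%R ^+ 2)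
    / ((a - l) * (b - l) * (c - l)).
Proof.
move=> la lb lc w.
rewrite /confocal_form /diag_form /w !mxE /=; field.
by rewrite !subr_eq0 ![_ == l]eq_sym la lb lc.
Qed.

Lemma pencil_gram_det a b c u v :
  let w := mcross u v in
  pencil a b c u u * pencil a b c v v - pencil a b c u v ^+ 2
  = (a%:P * 'X - 1) * (b%:P * 'X - 1) * (c%:P * 'X - 1)
    * ((a * w 0 0 ^+ 2 - b * w 0 1 ^+ 2 - c * w 0 2%R ^+ 2)%:P * 'X
       - (w 0 0 ^+ 2 - w 0 1 ^+ 2 - w 0 2%R ^+ 2)%:P).
Proof. by rewrite /pencil !mxE /=; ring. Qed.

(** * The geometry of one reflection *)

Lemma conormal_eq0 a b c P : a != 0 -> b != 0 -> c != 0 ->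
  conormal a b c P = 0 -> P = 0.
Proof.
move=> a0 b0 c0 /rowP N0.
apply: vec3P; [move: (N0 0)|move: (N0 1)|move: (N0 2%R)];
by rewrite !mxE /= => /eqP; rewrite mulf_eq0 invr_eq0 ?(negPf a0) ?(negPf b0)
  ?(negPf c0) orbF => /eqP.
Qed.

Lemma hyperboloid_neq0 P : mink P P = 1 -> P != 0.
Proof.
move=> hP; apply/eqP => P0; move: hP; rewrite P0 /mink /diag_form !mxE.
by rewrite !mulr0 !addr0 => /eqP; rewrite eq_sym oner_eq0.
Qed.

Lemma normal_conormal a b c P : a != 0 -> b != 0 -> c != 0 ->
  conic a b c 0 P -> normal_conic0 a b c P (conormal a b c P).
Proof.
move=> a0 b0 c0 [hP]; rewrite /cone /= confocal_conormal => hN; split.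
- by move: (hyperboloid_neq0 hP); apply: contra_neq; exact: conormal_eq0.
- by rewrite /tangent_hyperboloid /= minkC.
- by move=> v [_]; rewrite /= confocal_conormal.
Qed.

(** With N0 not light-like, P, N0 and their vector product form a frame, whose
third vector spans the tangent line of C_0; N minus its component along N0 is
orthogonal to all three. *)
Lemma normal_conic0_proportional a b c P N :
  let N0 := conormal a b c P in
  conic a b c 0 P -> mink N0 N0 != 0 -> normal_conic0 a b c P N ->
  exists t, N = t *: N0.
Proof.
move=> N0 [hP]; rewrite /cone /= confocal_conormal -/N0 => hN h0.
case=> _ PN tanN; exists (mink N N0 / mink N0 N0).
have PN0 : mink P N0 = 0 by rewrite minkC.
set w := mcross P N0.
have Nw : mink N w = 0.
  apply: tanN; split; first exact: mink_mcrossl.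
  by rewrite /= confocal_conormal; exact: mink_mcrossr.
set t := _ / _.
have E u : mink u (N - t *: N0) = mink u N - t * mink u N0.
  by rewrite /mink /diag_form !mxE; ring.
apply/eqP; rewrite -subr_eq0; apply/eqP.
apply: (@mink_frame_eq0 P N0 w).
- by rewrite mink_mcross_mcross PN0 hP mul1r expr0n sub0r oppr_eq0.
- by rewrite E PN PN0 mulr0 subr0.
- by rewrite E minkC divfK // subrr.
- by rewrite E !(minkC w) Nw mink_mcrossr mulr0 subr0.
Qed.

(** Otherwise P' = P or P' = -P, and the midpoint of the arc is the boundary
point P in the first case and the value 0 of the arc, off the hyperboloid, in
the second. *)
Lemma segment_mcross_neq0 a b c P P' :
  billiard_segment a b c P P' -> mcross P P' != 0.
Proof.
case=> [[hP cP] [hP' _] arc]; apply/eqP => w0.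
set m := mink P P'.
have eP' : P' = m *: P.
  apply/eqP; rewrite -subr_eq0; apply/eqP.
  transitivity (mink P P *: P' - m *: P); first by rewrite hP scale1r.
  transitivity (mcross P (mcross P P')).
    by apply: vec3P; rewrite /m /mink /diag_form !mxE /=; ring.
  by rewrite w0; apply: vec3P; rewrite !mxE /=; ring.
have : m ^+ 2 = 1.
  have : mink P' P' = 1 := hP'.
  by rewrite {1}eP' -[m *: P]addr0 -[0](scale0r P) minkDZl -/m mul0r addr0 expr2.
have h01 : 0 < (2^-1 : R) < 1 by lra.
have [] := arc _ h01; rewrite /geodesic_arc.
have -> : (1 - 2^-1) *: P + 2^-1 *: P' = ((1 + m) / 2) *: P.
  by rewrite eP' scalerA -scalerDl; congr (_ *: _); field.
move=> [hQ ncQ] _ /eqP; rewrite sqrf_eq1 => /orP[] /eqP m1; last first.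
  move: hQ; rewrite m1 addrN mul0r scale0r scaler0 /hyperboloid /=.
  by move/hyperboloid_neq0; rewrite eqxx.
apply: ncQ; rewrite m1 (_ : (1 + 1) / 2 = 1) ?scale1r; last by field.
by rewrite hP sqrtr1 invr1 scale1r.
Qed.

(** A segment is never tangent to C_0 at its end: otherwise the form of
parameter 0, which is nondegenerate in dimension 3, would vanish on the plane
of P and P'.  Concretely, the vector product W of the two conormals would be
orthogonal to them, hence parallel to both P and P', while its coordinates are
those of w = P x P' up to nonzero factors; so w = 0. *)
Lemma conormal_pairing_neq0 a b c P P' : a != 0 -> b != 0 -> c != 0 ->
  conic a b c 0 P -> conic a b c 0 P' -> mcross P P' != 0 ->
  mink (conormal a b c P) P' != 0.
Proof.
move=> a0 b0 c0 [_ cP] [_ cP'] w0; apply: contra_neq w0.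
move: cP cP'; rewrite /cone /= !confocal_conormal.
set M := conormal a b c P; set M' := conormal a b c P' => f00 f11 f01.
have f10 : mink M' P = 0 by rewrite -f01 /M /M' /mink /diag_form !mxE /=; ring.
set W := mcross M M'.
have triple Q : mcross W Q = mink M' Q *: M - mink M Q *: M'.
  by apply: vec3P; rewrite /W /mink /diag_form !mxE /=; ring.
have WP : mcross W P = 0 by rewrite triple f10 f00 !scale0r subr0.
have WP' : mcross W P' = 0 by rewrite triple f01 f11 !scale0r subr0.
set w := mcross P P'.
have W0 : w 0 0 = b * c * W 0 0.
  by rewrite !mxE /=; field; rewrite ?a0 ?b0 ?c0.
have W1 : w 0 1 = a * c * W 0 1.
  by rewrite !mxE /=; field; rewrite ?a0 ?b0 ?c0.
have W2 : w 0 2%R = a * b * W 0 2%R.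
  by rewrite !mxE /=; field; rewrite ?a0 ?b0 ?c0.
(* W is parallel to P and P', so every product W_i w_i vanishes. *)
have sq0 (x y k : R) : x = k * y -> y * x = 0 -> x = 0.
  by move=> ex yx0; apply/eqP; rewrite -sqrf_eq0 expr2 {1}ex -mulrA yx0 mulr0.
clearbody W.
have e0 := congr1 (fun v : vec => v 0 0) WP.
have e1 := congr1 (fun v : vec => v 0 1) WP.
have e2 := congr1 (fun v : vec => v 0 2%R) WP.
have f0 := congr1 (fun v : vec => v 0 0) WP'.
have f1 := congr1 (fun v : vec => v 0 1) WP'.
have f2 := congr1 (fun v : vec => v 0 2%R) WP'.
rewrite !mxE /= in e0 e1 e2 f0 f1 f2.
apply: vec3P; rewrite [RHS]mxE.
- apply: (sq0 _ _ _ W0); rewrite !mxE /=.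
  transitivity (P 0 0 * (W 0 2%R * P' 0 1 - W 0 1 * P' 0 2%R)
    - (W 0 2%R * P 0 0 - W 0 0 * P 0 2%R) * P' 0 1
    - (W 0 0 * P 0 1 - W 0 1 * P 0 0) * P' 0 2%R); first by ring.
  by rewrite f0 e1 e2; ring.
- apply: (sq0 _ _ _ W1); rewrite !mxE /=.
  transitivity (P 0 1 * (W 0 2%R * P' 0 0 - W 0 0 * P' 0 2%R)
    - (W 0 2%R * P 0 1 - W 0 1 * P 0 2%R) * P' 0 0
    + (W 0 0 * P 0 1 - W 0 1 * P 0 0) * P' 0 2%R); first by ring.
  by rewrite f1 e0 e2; ring.
- apply: (sq0 _ _ _ W2); rewrite !mxE /=.
  transitivity (P 0 2%R * (W 0 0 * P' 0 1 - W 0 1 * P' 0 0)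
    + (W 0 2%R * P 0 0 - W 0 0 * P 0 2%R) * P' 0 1
    - (W 0 2%R * P 0 1 - W 0 1 * P 0 2%R) * P' 0 0); first by ring.
  by rewrite f2 e0 e1; ring.
Qed.

(** The point of contact q lies in the plane of P and P' and is orthogonal to
it for the form of parameter nu, which is therefore degenerate there. *)
Lemma caustic_gram_det a b c nu P P' :
  tangent_to_cone a b c nu (plane_through P P') ->
  confocal_form a b c nu P P * confocal_form a b c nu P' P'
  - confocal_form a b c nu P P' ^+ 2 = 0.
Proof.
case=> q [q0 qq plane].
have polar v : plane_through P P' v -> confocal_form a b c nu q v = 0.
  by rewrite plane.
have [s [t eq]] : plane_through P P' q by rewrite plane.
have qP : confocal_form a b c nu q P = 0.
  by apply: polar; exists 1, 0; rewrite scale1r scale0r addr0.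
have qP' : confocal_form a b c nu q P' = 0.
  by apply: polar; exists 0, 1; rewrite scale1r scale0r add0r.
set d := (X in X = 0).
have sd : s * d = 0.
  transitivity (confocal_form a b c nu q P * confocal_form a b c nu P' P'
    - confocal_form a b c nu q P' * confocal_form a b c nu P P').
    by rewrite /d eq /confocal_form /diag_form !mxE; ring.
  by rewrite qP qP' !mul0r subr0.
have td : t * d = 0.
  transitivity (confocal_form a b c nu q P' * confocal_form a b c nu P P
    - confocal_form a b c nu q P * confocal_form a b c nu P P').
    by rewrite /d eq /confocal_form /diag_form !mxE; ring.
  by rewrite qP qP' !mul0r subr0.
apply: contraNeq q0 => d0; move/eqP: sd; move/eqP: td.
rewrite !mulf_eq0 (negPf d0) !orbF => /eqP t0 /eqP s0.
by rewrite eq s0 t0 !scale0r addr0.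
Qed.

Definition quartic (a b c nu : R) : {poly R} :=
  \prod_(r <- [:: a^-1; b^-1; c^-1; nu^-1]) ('X - r%:P).

(** By Cauchy-Binet the determinant is (a s - 1)(b s - 1)(c s - 1) (l1 s - l0).
Tangency to C_nu gives l1 = nu l0, and the leading coefficient is found from
the Gram determinant at l = 0, where the diagonal entries vanish. *)
Lemma pencil_gram_det_quartic a b c nu P P' :
  a != 0 -> b != 0 -> c != 0 -> [/\ nu != 0, nu != a, nu != b & nu != c] ->
  conic a b c 0 P -> conic a b c 0 P' ->
  tangent_to_cone a b c nu (plane_through P P') ->
  pencil a b c P P * pencil a b c P' P' - pencil a b c P P' ^+ 2
  = - ((a * b * c * mink (conormal a b c P) P') ^+ 2 *: quartic a b c nu).
Proof.
move=> a0 b0 c0 [nu0 nua nub nuc] [_ cP] [_ cP'] /caustic_gram_det.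
rewrite /cone /= in cP cP'.
rewrite confocal_gram_det // pencil_gram_det.
have := @confocal_gram_det a b c 0 P P'; rewrite cP cP' mul0r sub0r.
rewrite ![0 == _]eq_sym => /(_ a0 b0 c0); rewrite /= !subr0 confocal_conormal.
set f := mink _ _; set w := mcross P P'.
set l1 := a * _ - _ - _ => l1E l0E.
set l0 := _ - _ - _.
have {}l0E : l1 = nu * l0.
  move/eqP: l0E; rewrite !mulf_eq0 invr_eq0 !mulf_eq0 !subr_eq0.
  rewrite ![_ == nu]eq_sym (negPf nua) (negPf nub) (negPf nuc) !orbF => /eqP h.
  by apply/eqP; rewrite -subr_eq0 -[0](subrr ((c - nu) * w 0 2%R ^+ 2)) -{1}h
    /l1 /l0; apply/eqP; ring.
have -> : (a * b * c * f) ^+ 2 = - (a * b * c * l1).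
  apply/eqP; rewrite -eqr_oppLR exprMn -mulrN l1E; apply/eqP; field.
  by rewrite a0 b0 c0.
have lin (d : R) : d != 0 -> d%:P * 'X - 1 = d%:P * ('X - d^-1%:P).
  by move=> d0; rewrite mulrBr -polyCM mulfV.
have -> : l1%:P * 'X - l0%:P = l1%:P * ('X - nu^-1%:P).
  by rewrite mulrBr -polyCM [X in X / nu]l0E mulrAC mulfV // mul1r.
rewrite !lin // /quartic !big_cons big_nil -mul_polyC.
by ring.
Qed.

Lemma horner_quartic a b c nu s : (quartic a b c nu).[s] =
  (a^-1 - s) * (b^-1 - s) * (c^-1 - s) * (nu^-1 - s).
Proof. by rewrite /quartic !big_cons big_nil !hornerE /=; ring. Qed.

Lemma separable_quartic a b c nu :
  uniq [:: a; b; c; nu] -> separable_poly (quartic a b c nu).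
Proof.
move=> u; rewrite /quartic separable_prod_XsubC.
by rewrite -[X in uniq X]/(map GRing.inv [:: a; b; c; nu]) map_inj_uniq //;
  exact: invr_inj.
Qed.

(** The reflection law, with departure and arrival velocities expressed through
the bounce points; the coefficient of N1 is mu times the constant
2 <v, N1> / <N1, N1> of the reflection of the arrival velocity v, for which
<v, N1> = - <N1, P0>. *)
Lemma reflection_recurrence a b c P0 P1 P2 N (mu : R) :
  let N1 := conormal a b c P1 in
  conic a b c 0 P1 -> mink N1 N1 != 0 ->
  normal_conic0 a b c P1 N -> mink N N != 0 ->
  departure P1 P2 = mu *: reflection N (arrival P0 P1) ->
  exists t, P2 = t *: P1 - mu *: P0
                 - (- 2 * mu * mink N1 P0 / mink N1 N1) *: N1.
Proof.
move=> N1 conicP1 h0 hN NN0.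
have := conicP1; case=> [_]; rewrite /cone /= confocal_conormal -/N1 => N1P1.
have [t eN] := normal_conic0_proportional conicP1 h0 hN.
rewrite -/N1 in eN.
have t0 : t != 0.
  apply: contraNneq NN0 => t0; rewrite eN t0 scale0r /mink /diag_form !mxE.
  by rewrite !mulr0 !addr0.
rewrite /reflection (negPf NN0) /departure /arrival.
set m := mink P1 P2; set m' := mink P0 P1.
have -> : 2 * (mink (m' *: P1 - P0) N / mink N N) *: N
          = (- 2 * mink N1 P0 / mink N1 N1) *: N1.
  have -> : mink N N = t ^+ 2 * mink N1 N1.
    by rewrite eN /mink /diag_form !mxE; ring.
  have -> : mink (m' *: P1 - P0) N = t * (m' * mink N1 P1 - mink N1 P0).
    by rewrite eN /mink /diag_form !mxE; ring.
  rewrite N1P1 eN scalerA; congr (_ *: _); field.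
  by rewrite h0 t0.
move/eqP; rewrite subr_eq => /eqP ->.
exists (m + mu * m').
by apply: vec3P; rewrite !mxE; ring.
Qed.

(** The key to integrability: for the pencil, P2 behaves like T P1 - mu P0, the
conormal being replaced by s P1.  The discrepancies are multiples of <N1, u>;
they vanish for u = P1, and cancel in the square of P2 precisely because of
the factor 2 in the reflection law. *)
Lemma pencil_recurrence a b c P0 P1 P2 (t mu rho : R) :
  a != 0 -> b != 0 -> c != 0 ->
  let N1 := conormal a b c P1 in
  conic a b c 0 P1 ->
  rho * mink N1 N1 = - 2 * mu * mink N1 P0 ->
  P2 = t *: P1 - mu *: P0 - rho *: N1 ->
  let T := t%:P - rho%:P * 'X in
  pencil a b c P1 P2 = T * pencil a b c P1 P1 - mu%:P * pencil a b c P0 P1 /\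
  pencil a b c P2 P2 = T ^+ 2 * pencil a b c P1 P1
    - 2 * mu%:P * T * pencil a b c P0 P1 + mu%:P ^+ 2 * pencil a b c P0 P0.
Proof.
move=> a0 b0 c0 N1 [_] + hrho eP2 T.
rewrite /cone /= confocal_conormal -/N1 => N1P1.
set L := (a%:P * 'X - 1) * (b%:P * 'X - 1) * (c%:P * 'X - 1).
have E u : pencil a b c P2 u = T * pencil a b c P1 u
    - mu%:P * pencil a b c P0 u + rho%:P * L * (mink N1 u)%:P.
  transitivity (t%:P * pencil a b c P1 u - mu%:P * pencil a b c P0 u
                - rho%:P * pencil a b c N1 u).
    by rewrite {1}eP2 pencil_linear3.
  by rewrite pencil_conormal // -/L -/N1 /T; ring.
have E1 : pencil a b c P1 P2 = T * pencil a b c P1 P1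
                               - mu%:P * pencil a b c P0 P1.
  by rewrite pencilC E N1P1 mulr0 addr0.
have E0 : pencil a b c P0 P2 = T * pencil a b c P0 P1
    - mu%:P * pencil a b c P0 P0 + rho%:P * L * (mink N1 P0)%:P.
  by rewrite pencilC E (pencilC _ _ _ P1).
have N1P2 : mink N1 P2 = mu * mink N1 P0.
  transitivity (t * mink N1 P1 - mu * mink N1 P0 - rho * mink N1 N1).
    by rewrite eP2 /mink /diag_form !mxE; ring.
  by rewrite hrho N1P1; ring.
by split=> //; rewrite E E0 E1 N1P2; ring.
Qed.

End Billiard.

Theorem corollary5p2 (R : realType) (a b c nu : R) (n : nat)
  (habc : (0 < a /\ a < b /\ b < c) \/ (b < 0 /\ 0 < a /\ a < c))
  (hnu : [/\ nu != 0, nu != a, nu != b & nu != c])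
  (hn : (0 < n)%N)
  (hper : trajectories_periodic a b c nu n) :
  exists p q : {poly R},
    [/\ size p = n.+1, size q = n.-1 &
      forall s : R,
        p.[s] ^+ 2
        - (a^-1 - s) * (b^-1 - s) * (c^-1 - s) * (nu^-1 - s) * q.[s] ^+ 2
        = 1].
Proof.
have [a0 b0 c0] : [/\ a != 0, b != 0 & c != 0].
  by case: habc => [[? [? ?]]|[? [? ?]]]; split; apply/eqP => h; lra.
have dist : uniq [:: a; b; c; nu].
  case: (hnu) => nu0 nua nub nuc.
  rewrite /= !inE !negb_or ![_ == nu]eq_sym nua nub nuc !andbT.
  by case: habc => [[? [? ?]]|[? [? ?]]]; repeat (apply/andP; split);
    apply/eqP => h; lra.
have [[P [[[seg refl] reg] caus]] per] := hper.
have {}per : periodic_trajectory n P by apply: per.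
have con k : conic a b c 0 (P k) by have [] := seg k.
have f0 k : mink (conormal a b c (P k)) (P k.+1) != 0.
  exact: conormal_pairing_neq0 (segment_mcross_neq0 (seg k)).
have h0 k : let N := conormal a b c (P k) in mink N N != 0.
  exact/reg/normal_conormal.
pose al k := pencil a b c (P k) (P k).
pose be k := pencil a b c (P k) (P k.+1).
have rec k : exists t mu rho : R, [/\ 0 < mu, rho != 0,
     be k.+1 = (t%:P - rho%:P * 'X) * al k.+1 - mu%:P * be k &
     al k.+2 = (t%:P - rho%:P * 'X) ^+ 2 * al k.+1
       - 2 * mu%:P * (t%:P - rho%:P * 'X) * be k + mu%:P ^+ 2 * al k].
  have [N [hN [mu mu0 hdep]]] := refl k.
  have [t eP2] := reflection_recurrence (con k.+1) (h0 k.+1) hN (reg _ _ hN) hdep.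
  set rho := _ / _ in eP2.
  have hrho : rho * mink (conormal a b c (P k.+1)) (conormal a b c (P k.+1)) =
              - 2 * mu * mink (conormal a b c (P k.+1)) (P k).
    by rewrite /rho mulfVK // h0.
  exists t, mu, rho.
  have [e1 e2] := pencil_recurrence a0 b0 c0 (con k.+1) hrho eP2.
  split=> //; rewrite /rho !mulf_neq0 ?invr_eq0 ?h0 ?oppr_eq0 ?pnatr_eq0 //.
    by rewrite gt_eqF.
  by rewrite -confocal_conormal confocal_formC confocal_conormal f0.
have [x [y [z [w [d d0 [hd e00 e01 e11 [_ _ _ _ sxw]]]]]]] := monodromy rec n.
have [ean ebn ean1] : [/\ al n = al 0%N, be n = be 0%N & al n.+1 = al 1%N].
  by rewrite /al /be -(add0n n) -(addSn 0 n) !per.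
rewrite ean in e00; rewrite ebn in e01; rewrite ean1 in e11.
have detE := pencil_gram_det_quartic a0 b0 c0 hnu (con 0%N) (con 1%N) (caus 0%N).
rewrite -/(al 0%N) -/(al 1%N) -/(be 0%N) in detE.
set g := a * b * c * _ in detE.
have g0 : g != 0 by rewrite !mulf_neq0 // f0.
set D := quartic a b c nu in detE.
have sD : size D = 5%N by rewrite /D /quartic size_prod_XsubC.
have D0 : D != 0 by rewrite -size_poly_eq0 sD.
(* Comparing determinants gives d^2 = 1, and d > 0. *)
have d1 : d = 1.
  have : (al 0%N * al 1%N - be 0%N ^+ 2) * (d ^+ 2)%:P =
         al 0%N * al 1%N - be 0%N ^+ 2.
    rewrite -[RHS](congr2 _ (congr2 _ e00 e11) (congr1 (fun r => - r ^+ 2) e01)).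
    by rewrite polyC_exp -hd; ring.
  rewrite detE -[RHS]mulr1 => /(mulfI _) /=.
  rewrite oppr_eq0 scaler_eq0 (negPf D0) orbF expf_eq0 /= g0.
  move=> /(_ isT) /polyC_inj /eqP; rewrite sqrf_eq1 => /orP[] /eqP // dN1.
  by move: d0; rewrite dN1 oppr_gt0 ltr10.
rewrite d1 in hd.
have nz2 : (2%:R : R) != 0 by rewrite pnatr_eq0.
have [q hq] := pell_of_isometry nz2 g0 (separable_quartic dist) detE hd e00 e01 e11.
rewrite -/D in hq.
set p := _ *: _ in hq.
have sp : size p = n.+1 by rewrite /p size_scale ?invr_eq0.
exists p, q; split => //.
- have eDq : D * q ^+ 2 = p ^+ 2 - 1 by rewrite -hq; ring.
  have p0 : p != 0 by rewrite -size_poly_eq0 sp.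
  have sp2 : size (p ^+ 2) = (2 * n).+1.
    by rewrite expr2 size_mul // sp addnS /= mul2n -addnn.
  have sDq : size (D * q ^+ 2) = (2 * n).+1.
    by rewrite eDq size_polyDl ?sp2 // size_polyN size_poly1 ltnS muln_gt0.
  have q0 : q != 0.
    by apply: contra_eq_neq sDq => ->; rewrite expr0n mulr0 size_poly0.
  move: sDq; rewrite expr2 !size_mul ?mulf_neq0 // sD.
  move: q0; rewrite -size_poly_gt0; case: (size q) => [//|m] _ h; lia.
- move=> s.
  have := congr1 (fun r => r.[s]) hq.
  by rewrite hornerD hornerN horner_exp [X in _ - X]hornerM horner_exp horner_quartic
    hornerC.
Qed.
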